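(* Let $G$ be a finite simple graph with girth at least $8$. Then $G$ is b-continuous, i.e. $S_b(G) = [\chi(G), b(G)] \cap \mathbb{Z}$.
   Context: All graphs are finite and simple; the girth of a graph is the minimum length of a cycle in it (infinite if the graph has no cycle). A (proper) $k$-coloring of $G$ is a map $\psi: V(G)\to\mathbb{N}$ with $|\psi(V(G))|=k$ and $\psi(u)\neq\psi(v)$ whenever $uv\in E(G)$; the sets $\psi^{-1}(i)$ are the color classes. $\chi(G)$ is the chromatic number. Given a coloring $\psi$, a vertex $u$ is a b-vertex if $u$ has a neighbor in every color class other than $\psi^{-1}(\psi(u))$. A b-coloring is a coloring in which every color class contains at least one b-vertex. The b-spectrum $S_b(G)$ is the set of integers $k$ such that $G$ has a b-coloring with $k$ colors, and the b-chromatic number is $b(G)=\max S_b(G)$. $G$ is b-continuous if $S_b(G)=[\chi(G),b(G)]\cap\mathbb{Z}$. *)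

(* Defs.v *)
From mathcomp Require Import all_boot.
From mathcomp Require Import boolp classical_sets.

Set Implicit Arguments.
Unset Strict Implicit.
Unset Printing Implicit Defensive.

(* A finite simple graph is a symmetric irreflexive [e : rel T] on a finType. *)

Definition has_cycle_of_length (T : finType) (e : rel T) (n : nat) : bool :=
  (2 < n) && [exists c : n.-tuple T, ucycleb e c].

(* [None] stands for infinity; a cycle has at most [#|T|] vertices. *)
Definition girth (T : finType) (e : rel T) : option nat :=
  ohead [seq n <- iota 0 #|T|.+1 | has_cycle_of_length e n].

Definition girth_geq (T : finType) (e : rel T) (g : nat) : bool :=
  if girth e is Some n then g <= n else true.

Definition proper_coloring (T : finType) (e : rel T) (psi : T -> nat) : Prop :=
  forall u v : T, e u v -> psi u <> psi v.

Definition num_colors (T : finType) (psi : T -> nat) : nat :=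
  size (undup (codom psi)).

Definition k_coloring (T : finType) (e : rel T) (k : nat) (psi : T -> nat) :
    Prop :=
  proper_coloring e psi /\ num_colors psi = k.

Definition b_vertex (T : finType) (e : rel T) (psi : T -> nat) (u : T) : Prop :=
  forall i : nat, i \in codom psi -> i <> psi u ->
    exists2 v : T, e u v & psi v = i.

Definition b_coloring (T : finType) (e : rel T) (k : nat) (psi : T -> nat) :
    Prop :=
  k_coloring e k psi /\
  (forall i : nat, i \in codom psi -> exists2 u : T, psi u = i & b_vertex e psi u).

Definition b_spectrum (T : finType) (e : rel T) : set nat :=
  [set k | exists psi : T -> nat, b_coloring e k psi]%classic.

(* The range [k <= #|T|] loses nothing, and [ord_max] is an admissible starting
   point because an injective map is a coloring: see [chromatic_numberP]. *)
Definition chromatic_number (T : finType) (e : rel T) : nat :=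
  [arg min_(k < (ord_max : 'I_#|T|.+1)
            | `[< exists psi : T -> nat, k_coloring e k psi >]) k].

(* The range [k <= #|T|] loses nothing, and the default value 0 of [\max] is
   never used because the spectrum is nonempty: see [b_chromatic_numberP]. *)
Definition b_chromatic_number (T : finType) (e : rel T) : nat :=
  \max_(k < #|T|.+1 | `[< b_spectrum e k >]) k.

Definition b_continuous (T : finType) (e : rel T) : Prop :=
  b_spectrum e =
    [set k | (chromatic_number e <= k <= b_chromatic_number e)%N]%classic.

Lemma girth_geqP (T : finType) (e : rel T) (g : nat) :
  girth_geq e g <->
  (forall c : seq T, ucycle e c -> 2 < size c -> g <= size c).
Proof.
rewrite /girth_geq /girth.
set s := [seq _ <- _ | _].
have srt : sorted leq s.
  by apply: sorted_filter; [exact: leq_trans | exact: iota_sorted].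
have mems n : (n \in s) = has_cycle_of_length e n.
  rewrite mem_filter mem_iota /= add0n ltnS.
  case H: has_cycle_of_length => //=.
  case/andP: H => _ /existsP[c /andP[_ uc]].
  by rewrite -(size_tuple c) -(card_uniqP uc) max_card.
have cyc (c : seq T) : ucycle e c -> 2 < size c -> size c \in s.
  move=> uc sc; rewrite mems /has_cycle_of_length sc /=.
  by apply/existsP; exists (in_tuple c).
split.
  move=> H c uc sc; have := cyc c uc sc; move: H srt.
  case: s {mems cyc} => //= n s gn; rewrite path_sortedE; last exact: leq_trans.
  case/andP=> /allP le_n _; rewrite inE => /orP[/eqP->//|/le_n].
  exact: leq_trans.
move=> H; case: s mems {srt cyc} => //= n s /(_ n); rewrite mem_head.
case/esym/andP=> n2 /existsP[c uc].
by rewrite -(size_tuple c); apply: H => //; rewrite size_tuple.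
Qed.

Lemma num_colors_le (T : finType) (psi : T -> nat) : num_colors psi <= #|T|.
Proof. by rewrite (leq_trans (size_undup _)) // size_map cardE. Qed.

Lemma chromatic_numberP (T : finType) (e : rel T) : irreflexive e ->
  (exists psi, k_coloring e (chromatic_number e) psi) /\
  (forall k psi, k_coloring e k psi -> chromatic_number e <= k).
Proof.
move=> irr; rewrite /chromatic_number; case: arg_minnP.
  apply/asboolP; exists (fun x : T => nat_of_ord (enum_rank x)); split.
    move=> u v euv /ord_inj /enum_rank_inj uv.
    by move: euv; rewrite uv irr.
  rewrite /num_colors undup_id ?size_codom //.
  by apply/injectiveP => u v /ord_inj /enum_rank_inj.
move=> i /asboolP Pi le_i; split=> // k psi kpsi.
have lek : k < #|T|.+1 by case: kpsi => _ <-; rewrite ltnS num_colors_le.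
by apply: (le_i (Ordinal lek)); apply/asboolP; exists psi.
Qed.

Lemma chromatic_number_spectrum (T : finType) (e : rel T) :
  symmetric e -> irreflexive e -> b_spectrum e (chromatic_number e).
Proof.
move=> sym irr; have [[psi [prop npsi]] min] := chromatic_numberP irr.
exists psi; split=> // i ci; apply: contrapT => nob.
have miss u : psi u = i ->
    exists j, [/\ j \in codom psi, j <> i & forall v, e u v -> psi v <> j].
  move=> ui; apply: contrapT => H; apply: nob; exists u => // j cj ji.
  apply: contrapT => H'; apply: H; exists j; split=> //; first by rewrite -ui.
  by move=> v euv vj; apply: H'; exists v.
have ch u : exists j, psi u = i ->
    [/\ j \in codom psi, j <> i & forall v, e u v -> psi v <> j].
  have [/eqP /miss [j Hj]|/eqP ne] := boolP (psi u == i); first by exists j.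
  by exists 0.
have [f Hf] := choice ch.
pose phi u := if psi u == i then f u else psi u.
have pphi : proper_coloring e phi.
  move=> u v euv; rewrite /phi; case: eqP => [ui|_]; case: eqP => [vi|_].
  - by move: (prop _ _ euv); rewrite ui vi.
  - by case: (Hf u ui) => _ _ /(_ v euv) H /esym.
  - by case: (Hf v vi) => _ _ /(_ u); rewrite sym => /(_ euv).
  - exact: prop.
have := min _ phi (conj pphi erefl).
rewrite leqNgt => /negP; apply; rewrite -npsi /num_colors.
have -> : size (undup (codom psi)) = (size (rem i (undup (codom psi)))).+1.
  rewrite size_rem ?mem_undup // prednK //.
  by case: (undup _) (ci) (mem_undup (codom psi) i) => //= ->.
rewrite ltnS; apply: uniq_leq_size; first exact: undup_uniq.
move=> j; rewrite mem_undup => /codomP[u ->].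
rewrite mem_rem_uniq ?undup_uniq // inE mem_undup /= /phi.
case: (psi u =P i) => [ui|/eqP ne]; last by rewrite ne codom_f.
by case: (Hf u ui) => -> /eqP ->.
Qed.

Lemma b_chromatic_numberP (T : finType) (e : rel T) :
  symmetric e -> irreflexive e ->
  b_spectrum e (b_chromatic_number e) /\
  (forall k, b_spectrum e k -> k <= b_chromatic_number e).
Proof.
move=> sym irr; have bnd k : b_spectrum e k -> k < #|T|.+1.
  by case=> psi [[_ <-] _]; rewrite ltnS num_colors_le.
have chiS := chromatic_number_spectrum sym irr; split; last first.
  move=> k Sk; have lek := bnd k Sk.
  rewrite /b_chromatic_number; apply: (leq_bigmax_cond (Ordinal lek)).
  by apply/asboolP.
pose i0 := Ordinal (bnd _ chiS).
rewrite /b_chromatic_number (bigmax_eq_arg i0); last by apply/asboolP.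
by case: arg_maxnP => [|i /asboolP //]; apply/asboolP.
Qed.

(* Main.v *)
(* Since chi(G) is in the spectrum, it suffices to pass from k+1 colors to k
   when k > chi(G).  Number the colors 0, ..., k, call a vertex good if it sees
   every color 1, ..., k other than its own, keep one good vertex per color
   1, ..., k, and take color class 0 as small as possible.  A vertex x of color 0
   is good, else it could be recolored.
   If x has a good neighbor in each color 1, ..., k, a coloring of the ball of
   radius 2 around x in which x and k-1 of its neighbors are b-vertices extends
   to G: outside the ball take a coloring with at most k-1 colors and give the
   last color to the vertices at distance 3 in conflict with the ball; they are
   independent since the girth is at least 8.
   Otherwise let M be the set of colors c such that no neighbor of x of color c
   is good.  For c in M, recolor the neighbors of x of color c and give x color c.
   Only the colors all of whose good vertices are adjacent to a recolored
   neighbor are lost; by minimality there is such a color u(c), and u(c) is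
   in M.  As G has no 4-cycle, u is injective, so it permutes M, and hence for
   every color of M all the good vertices are at distance 2 from x.  This leaves
   room to repair u(c): a good vertex b of color u(c) now sees twice the new
   color of a neighbor y0 it shares with x, and its other neighbor z with that
   color can be given color c, after recoloring the neighbors of z of color c. *)

Require Import Defs.
From mathcomp Require Import all_boot.
From mathcomp Require Import boolp.

Set Implicit Arguments.
Unset Strict Implicit.
Unset Printing Implicit Defensive.

Section GirthEight.

Variables (T : finType) (e : rel T).
Hypotheses (e_sym : symmetric e) (e_irr : irreflexive e).
Hypothesis e_girth : girth_geq e 8.

(** * Closed walks of length three to seven *)

Lemma edge_neq u v : e u v -> u != v.
Proof. by apply: contraTneq => ->; rewrite e_irr. Qed.

Lemma no_short_cycle (c : seq T) :
  uniq c -> cycle e c -> 2 < size c < 8 -> False.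
Proof.
move=> uc cc /andP[c3 c8].
have /girth_geqP/(_ c) := e_girth; rewrite /ucycle cc uc => /(_ isT c3).
by rewrite leqNgt c8.
Qed.

Lemma no_triangle a b c : e a b -> e b c -> e c a -> False.
Proof.
move=> ab bc ca; apply: (@no_short_cycle [:: a; b; c]) => //=.
  rewrite !inE !negb_or (edge_neq ab) (edge_neq bc) /=.
  by rewrite eq_sym (edge_neq ca).
by rewrite ab bc ca.
Qed.

Lemma no_square a b c d :
  e a b -> e b c -> e c d -> e d a -> a != c -> b != d -> False.
Proof.
move=> ab bc cd da ac bd; apply: (@no_short_cycle [:: a; b; c; d]) => //=.
  rewrite !inE !negb_or (edge_neq ab) (edge_neq bc) (edge_neq cd) ac bd /=.
  by rewrite eq_sym (edge_neq da).
by rewrite ab bc cd da.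
Qed.

(** A repeated vertex in an odd closed walk splits off a shorter odd one, so no distinctness is
    assumed here or for heptagons. Even walks can backtrack, whence the inequalities for squares and
    hexagons. *)
Lemma no_pentagon a b c d f :
  e a b -> e b c -> e c d -> e d f -> e f a -> False.
Proof.
move=> ab bc cd df fa.
have ac : a != c by apply/eqP => E; subst c; exact: (no_triangle cd df fa).
have ad : a != d by apply/eqP => E; subst d; exact: (no_triangle ab bc cd).
have bd : b != d by apply/eqP => E; subst d; exact: (no_triangle ab df fa).
have bf : b != f by apply/eqP => E; subst f; exact: (no_triangle bc cd df).
have cf : c != f by apply/eqP => E; subst f; exact: (no_triangle ab bc fa).
apply: (@no_short_cycle [:: a; b; c; d; f]) => //=.
  rewrite !inE !negb_or (edge_neq ab) (edge_neq bc) (edge_neq cd).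
  by rewrite (edge_neq df) ac ad bd bf cf /= eq_sym (edge_neq fa).
by rewrite ab bc cd df fa.
Qed.

Lemma no_hexagon a b c d f g :
  e a b -> e b c -> e c d -> e d f -> e f g -> e g a ->
  a != c -> b != d -> c != f -> d != g -> f != a -> g != b -> False.
Proof.
move=> ab bc cd df fg ga ac bd cf dg fa gb.
have ad : a != d by apply/eqP => E; subst d; exact: (no_triangle ab bc cd).
have bf : b != f by apply/eqP => E; subst f; exact: (no_triangle bc cd df).
have cg : c != g by apply/eqP => E; subst g; exact: (no_triangle cd df fg).
apply: (@no_short_cycle [:: a; b; c; d; f; g]) => //=.
  rewrite !inE !negb_or (edge_neq ab) (edge_neq bc) (edge_neq cd).
  rewrite (edge_neq df) (edge_neq fg) ac ad bd bf cf cg dg /=.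
  by rewrite ![a == _]eq_sym (edge_neq ga) fa eq_sym gb.
by rewrite ab bc cd df fg ga.
Qed.

Lemma no_heptagon a b c d f g h :
  e a b -> e b c -> e c d -> e d f -> e f g -> e g h -> e h a -> False.
Proof.
move=> ab bc cd df fg gh ha.
have ac : a != c by apply/eqP => E; subst c; apply: (no_pentagon cd df fg gh ha).
have bd : b != d by apply/eqP => E; subst d; apply: (no_pentagon df fg gh ha ab).
have cf : c != f by apply/eqP => E; subst f; apply: (no_pentagon fg gh ha ab bc).
have dg : d != g by apply/eqP => E; subst g; apply: (no_pentagon gh ha ab bc cd).
have fh : f != h by apply/eqP => E; subst h; apply: (no_pentagon ha ab bc cd df).
have ga : g != a by apply/eqP => E; subst g; apply: (no_pentagon ab bc cd df fg).
have hb : h != b by apply/eqP => E; subst h; apply: (no_pentagon bc cd df fg gh).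
have ad : a != d by apply/eqP => E; subst d; exact: (no_triangle ab bc cd).
have bf : b != f by apply/eqP => E; subst f; exact: (no_triangle bc cd df).
have cg : c != g by apply/eqP => E; subst g; exact: (no_triangle cd df fg).
have dh : d != h by apply/eqP => E; subst h; exact: (no_triangle df fg gh).
have fa : f != a by apply/eqP => E; subst f; exact: (no_triangle fg gh ha).
have gb : g != b by apply/eqP => E; subst g; exact: (no_triangle gh ha ab).
have hc : h != c by apply/eqP => E; subst h; exact: (no_triangle ha ab bc).
apply: (@no_short_cycle [:: a; b; c; d; f; g; h]) => //=.
  rewrite !inE !negb_or (edge_neq ab) (edge_neq bc) (edge_neq cd).
  rewrite (edge_neq df) (edge_neq fg) (edge_neq gh) ac ad bd bf cf cg dg dh fh.
  rewrite ![a == _]eq_sym (edge_neq ha) fa ga ![b == _]eq_sym gb hb.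
  by rewrite [c == h]eq_sym hc.
by rewrite ab bc cd df fg gh ha.
Qed.

(** * Colorings with colors numbered in an interval *)

Lemma b_spectrum_intro (k : nat) (psi : T -> nat) :
  proper_coloring e psi -> (forall v, 0 < psi v <= k) ->
  (forall i, 0 < i <= k -> exists2 u, psi u = i &
    forall j, 0 < j <= k -> j <> i -> exists2 v, e u v & psi v = j) ->
  b_spectrum e k.
Proof.
move=> prop rng bv; exists psi; split; first split=> //.
  rewrite /num_colors -[RHS](size_iota 1 k); apply/perm_size/uniq_perm.
  - exact: undup_uniq.
  - exact: iota_uniq.
  move=> i; rewrite mem_undup mem_iota add1n ltnS.
  apply/codomP/idP => [[v ->] //|/bv[u <- _]]; by exists u.
move=> i /codomP[w iw]; have := rng w; rewrite -iw => /bv[u ui ub].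
exists u => // j /codomP[z jz]; rewrite ui => ji.
by apply: ub => //; rewrite jz.
Qed.

Lemma coloring_index (n : nat) (psi : T -> nat) :
  k_coloring e n psi ->
  exists2 s : seq nat, size s = n & [/\ uniq s, s =i codom psi &
    forall v, index (psi v) s < n].
Proof.
case=> prop <-; exists (undup (codom psi)) => //.
split; [exact: undup_uniq | exact: mem_undup |].
by move=> v; rewrite index_mem mem_undup codom_f.
Qed.

(** * Good vertices and the color to be eliminated *)

Section Coloring.

Variable k : nat.
Implicit Types (f : T -> 'I_k.+1) (i c : 'I_k.+1).

Definition proper f := forall u v, e u v -> f u != f v.

Definition sees f v i := [exists w, e v w && (f w == i)].

(* Color [ord0] is the one to be eliminated: [good] ignores it. *)
Definition good f v :=
  [forall i, (i != ord0) ==> (i != f v) ==> sees f v i].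

(** A b-coloring with k + 1 colors, relaxed so as to survive recoloring: color [ord0] needs no good
    vertex and may be empty. Once it is empty, a b-coloring with k colors is left. *)
Definition realizes f :=
  proper f /\ forall i, i != ord0 -> exists2 v, f v = i & good f v.

(** The default [ord0] occurs only for good [v]; any other vertex can be moved alone to this
    color. *)
Definition missing f v : 'I_k.+1 :=
  odflt ord0 [pick i | [&& i != ord0, i != f v & ~~ sees f v i]].

Lemma goodP f v :
  reflect (forall i, i != ord0 -> i != f v -> exists2 w, e v w & f w = i)
          (good f v).
Proof.
apply: (iffP forallP) => [H i i0 iv|H i].
  by have /implyP/(_ i0)/implyP/(_ iv)/existsP[w /andP[vw /eqP]] := H i; exists w.
apply/implyP => i0; apply/implyP => iv; have [w vw <-] := H i i0 iv.
by apply/existsP; exists w; rewrite vw eqxx.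
Qed.

Lemma missingP f v : ~~ good f v ->
  [/\ missing f v != ord0, missing f v != f v &
    forall w, e v w -> f w != missing f v].
Proof.
rewrite negb_forall => /existsP[i]; rewrite 2!negb_imply => ng.
rewrite /missing; case: pickP => [j /and3P[j0 jv nj]|/(_ i)/negbT/negP[]] //.
split=> // w vw; apply: contra nj => fw; apply/existsP; exists w.
by rewrite vw.
Qed.

Lemma class0_decrease f f' x : f x = ord0 -> f' x != ord0 ->
  (forall v, f' v = ord0 -> f v = ord0) ->
  #|[pred v | f' v == ord0]| < #|[pred v | f v == ord0]|.
Proof.
move=> fx f'x H; apply/proper_card/properP; split.
  by apply/subsetP => v; rewrite !inE => /eqP/H ->.
by exists x; rewrite !inE ?fx.
Qed.

Definition smaller f :=
  exists2 f', realizes f' &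
    #|[pred v | f' v == ord0]| < #|[pred v | f v == ord0]|.

(** Moving [x] to its missing color harms no good vertex, since [good] ignores the color that [x]
    gives up. *)
Lemma not_good_smaller f x :
  realizes f -> f x = ord0 -> ~~ good f x -> smaller f.
Proof.
move=> [prop real] fx /missingP[m0 mx mP].
pose f' v := if v == x then missing f x else f v.
have f'x : f' x = missing f x by rewrite /f' eqxx.
have f'n v : f v != ord0 -> f' v = f v.
  by rewrite /f'; case: (v =P x) => // ->; rewrite fx eqxx.
exists f'; last first.
  apply: (@class0_decrease _ _ x); rewrite ?f'x // => v.
  by rewrite /f'; case: eqP => [->|].
split=> [u v uv|i i0].
  rewrite /f'; case: (u =P x) => [ux|_]; case: (v =P x) => [vx|_].
  - by move: uv; rewrite ux vx e_irr.
  - by rewrite eq_sym mP // -ux.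
  - by rewrite mP // -vx e_sym.
  - exact: prop.
have [g gi /goodP gg] := real i i0.
have f'g : f' g = i by rewrite f'n gi.
exists g => //; apply/goodP => j j0; rewrite f'g -gi => jg.
by have [w gw wj] := gg j j0 jg; exists w => //; rewrite f'n wj.
Qed.

(** * A vertex of color 0 with a good neighbor in every other color *)

Lemma iris_b_spectrum f x (phi : T -> nat) :
  proper f -> f x = ord0 ->
  (forall c, c != ord0 -> exists v, [/\ e x v, f v = c & good f v]) ->
  proper_coloring e phi -> (forall v, 0 < phi v < k) ->
  b_spectrum e k.
Proof.
move=> prop fx iris pphi rphi.
have k2 : 1 < k by case/andP: (rphi x) => p0; apply: leq_trans.
have k0 : 0 < k by apply: ltnW.
have f_le v : f v <= k by rewrite -ltnS.
have fxN v : e x v -> 0 < f v.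
  by move=> xv; rewrite lt0n; have := prop _ _ xv; rewrite fx eq_sym.
pose S2 v := [exists y, e x y && e y v].
(* A neighbor of [x] of color k becomes 1, so its further neighbors can take k. The other vertices
   at distance 2 keep their color, with k in place of 0. *)
pose h v := if [exists y, [&& e x y, e y v & f y == k :> nat]] then k
            else if f v == 0 :> nat then k else f v.
pose conflict v := [exists w, [&& w != x, S2 w, e w v & h w == phi v]].
pose g v := if v == x then k
  else if e x v then (if f v == k :> nat then 1 else f v)
  else if S2 v then h v
  else if conflict v then k else phi v.
have h_rng v : 0 < h v <= k.
  rewrite /h; case: ifP => _; first by rewrite k0 leqnn.
  by case: eqP => [_|/eqP]; rewrite ?k0 ?leqnn // f_le lt0n => ->.
have S2P v : reflect (exists2 y, e x y & e y v) (S2 v).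
  apply: (iffP existsP) => [[y /andP[]]|[y xy yv]]; exists y => //.
  by rewrite xy.
have sameparent y y' v : e x y -> e y v -> e x y' -> e y' v -> v != x -> y = y'.
  move=> xy yv xy' y'v vx; apply/eqP/negPn/negP => yy'.
  by apply: (@no_square x y v y') => //; rewrite 1?e_sym // eq_sym.
have hN y v : e x y -> e y v -> v != x -> f y != k :> nat ->
    h v = if f v == 0 :> nat then k else f v.
  move=> xy yv vx yk; rewrite /h ifN //; apply: contra yk.
  by case/existsP=> y' /and3P[xy' y'v]; rewrite (sameparent _ _ _ xy yv xy' y'v).
have hK y v : e x y -> e y v -> f y = k :> nat -> h v = k.
  move=> xy yv yk; rewrite /h ifT //; apply/existsP; exists y.
  by rewrite xy yv yk eqxx.
have gx : g x = k by rewrite /g eqxx.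
have g1 v : e x v -> g v = if f v == k :> nat then 1 else f v.
  by move=> xv; rewrite /g xv eq_sym (negbTE (edge_neq xv)).
have g2 y v : v != x -> e x y -> e y v -> g v = h v.
  move=> vx xy yv; rewrite /g (negbTE vx).
  case: ifP => [xv|_].
    by case: (no_triangle xy yv); rewrite e_sym.
  by have /S2P -> : exists2 y, e x y & e y v by exists y.
have gprop : proper_coloring e g.
  have gx1 v : e x v -> g x <> g v.
    move=> xv; rewrite gx g1 //; case: eqP => [_ E|nk /esym //].
    by move: k2; rewrite E.
  have g12 u v : e x u -> e u v -> v != x -> g u <> g v.
    move=> xu uv vx; rewrite g1 // (g2 u) //; case: eqP => [uk|/eqP uk].
      by rewrite (hK u) // => E; move: k2; rewrite -E.
    rewrite (hN u) //; case: eqP => _; first exact/eqP.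
    by move=> /ord_inj/eqP; apply/negP; exact: prop.
  have g23 u v : u != x -> S2 u -> e u v -> v != x -> ~~ e x v -> ~~ S2 v ->
      g u <> g v.
    move=> ux /[dup] u2 /S2P[y xy yu] uv vx nxv nv.
    rewrite (g2 y) // /g (negbTE vx) (negbTE nxv) (negbTE nv).
    (* Here [v] got color k because of [w]. By the girth [u] is the only neighbor of [v] at distance
       2 from [x], so [u] is [w] and its color [phi v] is below k. *)
    case: ifPn => [/existsP[w /and4P[wx /S2P[y' xy' y'w] wv /eqP hw]]|ncf].
      have [uw|uw] := eqVneq u w.
        by rewrite uw hw => E; have := rphi v; rewrite E ltnn andbF.
      have [yy'|yy'] := eqVneq y y'.
        have yv : y != v by apply: contraNneq nxv => <-.
        have wy : e w y by rewrite yy' e_sym.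
        by case: (no_square yu uv _ wy yv uw); rewrite e_sym.
      case: (@no_hexagon x y u v w y') => //; rewrite 1?e_sym // 1?eq_sym //.
      - by apply: contraNneq nxv => ->.
      - by apply: contraNneq nxv => <-.
    move=> E; case/negP: ncf; apply/existsP; exists u.
    by rewrite ux u2 uv E eqxx.
  have g33 u v : u != x -> ~~ e x u -> ~~ S2 u -> e u v ->
      v != x -> ~~ e x v -> ~~ S2 v -> g u <> g v.
    move=> ux xu u2 uv vx xv v2; rewrite /g (negbTE ux) (negbTE xu) (negbTE u2).
    rewrite (negbTE vx) (negbTE xv) (negbTE v2).
    have lt w : phi w <> k.
      by move=> E; have := rphi w; rewrite E ltnn andbF.
    case: ifP => [/existsP[w /and4P[wx /S2P[y xy yw] wu _]]|_]; last first.
      by case: ifP => _; [exact: lt | exact: pphi].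
    (* Two adjacent vertices in conflict would close a walk of length 7 through [x]. *)
    case: ifP => [/existsP[w' /and4P[w'x /S2P[y' xy' y'w'] w'v _]]|_].
      by case: (@no_heptagon x y w u v w' y'); rewrite // e_sym.
    exact/nesym.
  have no22 u v : S2 u -> S2 v -> e u v -> False.
    move=> /S2P[y xy yu] /S2P[y' xy' y'v] uv.
    by apply: (@no_pentagon x y u v y'); rewrite // e_sym.
  move=> u v uv; have vu : e v u by rewrite e_sym.
  have [ux|ux] := eqVneq u x; first by rewrite ux; apply: gx1; rewrite -ux.
  have [vx|vx] := eqVneq v x; first by rewrite vx; apply/nesym/gx1; rewrite -vx.
  have [xu|xu] := boolP (e x u); first exact: g12.
  have [xv|xv] := boolP (e x v); first exact/nesym/g12.
  have [u2|u2] := boolP (S2 u); have [v2|v2] := boolP (S2 v).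
  - by case: (no22 u v).
  - exact: g23.
  - exact/nesym/g23.
  - exact: g33.
apply: (@b_spectrum_intro _ g) => // [v|i /andP[i0 ik]].
  rewrite /g; case: ifP => _; first by rewrite k0 leqnn.
  case: ifP => [xv|_]; first by case: eqP => _; rewrite ?k0 // fxN // f_le.
  case: ifP => _; first exact: h_rng.
  case: ifP => _; first by rewrite k0 leqnn.
  by have /andP[-> /ltnW ->] := rphi v.
have ordE (j : nat) : 0 < j <= k ->
    exists c : 'I_k.+1, (c != ord0) /\ (c = j :> nat).
  case/andP=> j0 jk; have jk' : j < k.+1 by [].
  by exists (Ordinal jk'); rewrite -val_eqE /= -lt0n.
have nbr (j : nat) : 0 < j < k -> exists v, [/\ e x v, f v = j :> nat, g v = j & good f v].
  case/andP=> j0 jk; have [|c [c0 cj]] := ordE j; first by rewrite j0 ltnW.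
  have [v [xv fv gv]] := iris c c0; exists v; split; rewrite ?fv //.
  by rewrite g1 // fv cj ltn_eqF.
(* The b-vertex of color k is [x]. For i < k it is the good neighbor of color i, which sees k at [x]
   and the other colors on unchanged vertices at distance 2. *)
have [ik'|ik'] := eqVneq i k.
  exists x; first by rewrite gx ik'.
  move=> j /andP[j0 jk] ji; have [|v [xv _ gv _]] := nbr j; last by exists v.
  by rewrite j0 ltn_neqAle jk -ik' andbT; apply/eqP.
have [|v [xv fv gv /goodP vg]] := nbr i; first by rewrite i0 ltn_neqAle ik' ik.
exists v => // j /andP[j0 jk] ji.
have [->|jk'] := eqVneq j k; first by exists x; rewrite // e_sym.
have [|c [c0 cj]] := ordE j; first by rewrite j0.
have [|w vw wc] := vg c c0; first by rewrite -val_eqE /= cj fv; apply/eqP.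
have wx : w != x by apply: contraNneq c0 => wx; rewrite -wc wx fx.
exists w => //; rewrite (g2 v) // (hN v) //; last by rewrite fv.
by rewrite wc cj eqn0Ngt j0.
Qed.

(** * Recoloring a set of vertices and its neighbors *)

Definition recolor f c (Z : {set T}) v : 'I_k.+1 :=
  if v \in Z then c
  else if (f v == c) && [exists z in Z, e z v] then missing f v else f v.

Lemma recolor_in f c (Z : {set T}) v : v \in Z -> recolor f c Z v = c.
Proof. by rewrite /recolor => ->. Qed.

Lemma recolor_id f c (Z : {set T}) v :
  v \notin Z -> (f v = c -> forall z, z \in Z -> e z v -> False) ->
  recolor f c Z v = f v.
Proof.
move=> vZ H; rewrite /recolor (negbTE vZ); case: ifP => // /andP[/eqP/H{}H].
by case/existsP=> z /andP[/H{}H /H].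
Qed.

(** The neighbors of [Z] that give way all have color [c], so they are pairwise nonadjacent and can
    move to their missing colors at the same time. *)
Lemma recolor_smaller f c (Z : {set T}) x :
  proper f -> c != ord0 -> x \in Z -> f x = ord0 ->
  {in Z &, forall u v, ~~ e u v} ->
  (forall z v, z \in Z -> e z v -> f v = c -> ~~ good f v) ->
  (forall i, i != ord0 ->
     exists2 v, recolor f c Z v = i & good (recolor f c Z) v) ->
  smaller f.
Proof.
move=> prop c0 xZ fx indep ng real; exists (recolor f c Z); last first.
  apply: (@class0_decrease _ _ x); rewrite ?recolor_in // => v.
  rewrite /recolor; case: ifP => [_ E|_]; first by rewrite E eqxx in c0.
  case: ifP => // /andP[/eqP fv /existsP[z /andP[zZ zv]]] m0.
  by have [] := missingP (ng z v zZ zv fv); rewrite m0 eqxx.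
split=> //.
have mP v : (f v == c) && [exists z in Z, e z v] ->
    missing f v != c /\ forall w, e v w -> f w != missing f v.
  case/andP=> /eqP fv /existsP[z /andP[zZ zv]].
  by have [_] := missingP (ng z v zZ zv fv); rewrite fv.
have HZ u v : u \in Z -> e u v -> c != recolor f c Z v.
  move=> uZ uv; rewrite /recolor ifN; last first.
    by apply/negP => vZ; case/negP: (indep u v uZ vZ).
  rewrite eq_sym; case: ifP => [/mP[] //|/negbT].
  rewrite negb_and => /orP[//|/existsP[]]; exists u.
  by rewrite uZ.
move=> u v uv; have vu : e v u by rewrite e_sym.
have [uZ|uZ] := boolP (u \in Z); first by rewrite (recolor_in _ _ uZ); exact: HZ uv.
have [vZ|vZ] := boolP (v \in Z).
  by rewrite (recolor_in _ _ vZ) eq_sym; exact: HZ vu.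
rewrite /recolor (negbTE uZ) (negbTE vZ).
case: ifP => [mu|_]; case: ifP => [mv|_].
- have := prop u v uv; have /andP[/eqP-> _] := mu.
  by have /andP[/eqP-> _] := mv; rewrite eqxx.
- by rewrite eq_sym; apply: (mP u mu).2.
- exact: (mP v mv).2.
- exact: prop.
Qed.

(** These colors form the set M. *)
Definition removable f x c :=
  (c != ord0) && [forall v, e x v ==> (f v == c) ==> ~~ good f v].

(* Recoloring the neighbors of [x] of color [c] may cost [i] its good vertices. *)
Definition attached f x c i :=
  [forall g, good f g ==> (f g == i) ==>
     [exists y, [&& e x y, f y == c & e y g]]].

Lemma attachedP f x c i g : attached f x c i -> good f g -> f g = i ->
  exists y, [/\ e x y, f y = c & e y g].
Proof.
move=> /forallP/(_ g)/implyP H /H/implyP{}H /eqP/H/existsP[y].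
by case/and3P=> xy /eqP fy yg; exists y.
Qed.

Lemma removableP f x c v :
  removable f x c -> e x v -> f v = c -> ~~ good f v.
Proof. by case/andP=> _ /forallP/(_ v)/implyP H /H/implyP{}H /eqP. Qed.

Lemma not_removableP f x c : c != ord0 -> ~~ removable f x c ->
  exists v, [/\ e x v, f v = c & good f v].
Proof.
rewrite /removable => -> /= /forallPn[v]; rewrite 2!negb_imply negbK.
by case/and3P=> xv /eqP fv gv; exists v.
Qed.

(** Recoloring with [Z] reduced to [x] makes [x] the good vertex of color [c]. A color that is not
    attached has a good vertex adjacent to no recolored neighbor of [x], and it still sees all it
    needs. *)
Lemma unattached_smaller f x c :
  realizes f -> f x = ord0 -> good f x -> removable f x c ->
  (forall i, i != ord0 -> i != c -> ~~ attached f x c i) -> smaller f.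
Proof.
move=> [prop real] fx /goodP gx rem unatt; have [c0 _] := andP rem.
have f'x : recolor f c [set x] x = c by rewrite recolor_in ?inE.
have f'E v : f v != ord0 -> (f v = c -> e x v -> False) ->
    recolor f c [set x] v = f v.
  move=> v0 H; apply: recolor_id => [|/H vc z].
    by rewrite inE; apply: contraNneq v0 => ->; rewrite fx.
  by rewrite inE => /eqP ->.
apply: (@recolor_smaller _ c [set x] x); rewrite ?inE //.
- by move=> u v; rewrite !inE => /eqP-> /eqP->; rewrite e_irr.
- by move=> z v; rewrite inE => /eqP->; exact: removableP.
move=> i i0; have [->|ic] := eqVneq i c.
  exists x => //; apply/goodP => j j0; rewrite f'x => jc.
  have [|w xw wj] := gx j j0; first by rewrite fx.
  by exists w => //; rewrite f'E wj // => E; rewrite E eqxx in jc.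
have /forallPn[g] := unatt i i0 ic.
rewrite 2!negb_imply => /and3P[/goodP gg /eqP gi /existsPn nadj].
have f'g : recolor f c [set x] g = i.
  by rewrite f'E gi // => E; rewrite E eqxx in ic.
exists g => //; apply/goodP => j j0; rewrite f'g -gi => jg.
have [w gw wj] := gg j j0 jg; exists w => //; rewrite f'E ?wj //.
move=> jc xw; have := nadj w.
by rewrite xw wj jc eqxx e_sym gw.
Qed.

(** * The case of a nonempty set M *)

Lemma removable_smaller f x c0 :
  realizes f -> f x = ord0 -> good f x -> removable f x c0 -> smaller f.
Proof.
move=> real fx gx rem0; have [prop core] := real.
apply: contrapT => nsm.
have att c : removable f x c ->
    exists i, [/\ i != ord0, i != c & attached f x c i].
  move=> rem; apply: contrapT => H; apply: nsm.
  apply: (@unattached_smaller f x c) => // i i0 ic; apply/negP => ai.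
  by apply: H; exists i.
(* A good neighbor of [x] of color [i] would have a common neighbor with [x], closing a triangle. *)
have att_removable c i : i != ord0 -> attached f x c i -> removable f x i.
  move=> i0 ai; apply/negPn/negP => /(not_removableP i0)[v [xv fv gv]].
  have [y [xy _ yv]] := attachedP ai gv fv.
  by case: (no_triangle xy yv); rewrite e_sym.
have att_inj c c' i : i != ord0 -> attached f x c i -> attached f x c' i ->
    c = c'.
  move=> i0 ai ai'; have [g gi gg] := core i i0.
  have [y [xy <- yg]] := attachedP ai gg gi.
  have [y' [xy' <- y'g]] := attachedP ai' gg gi.
  have [-> //|yy'] := eqVneq y y'; have [xg|xg] := eqVneq x g.
    by move: i0; rewrite -gi -xg fx eqxx.
  by case: (no_square xy yg _ _ xg yy'); rewrite e_sym.
(* Outside M the map is the identity, so that [u] is an injective self-map of the finite set of all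
   colors, hence bijective. *)
have /choice[u uP] c : exists i, if removable f x c
    then [/\ i != ord0, i != c & attached f x c i] else i = c.
  by have [/att|_] := boolP (removable f x c); last by exists c.
have uR c : removable f x (u c) = removable f x c.
  have := uP c; case: ifP => [_ [u0 _ /att_removable->] //|rc ->].
  by rewrite rc.
have u_inj : injective u.
  move=> c c' E; have := uP c; have := uP c'.
  rewrite -(uR c) -(uR c') E; case: ifP => [_|_ -> ->] //.
  by move=> [u0 _ a'] [_ _ a]; exact: att_inj a a'.
have [d0 dc ad] : [/\ u c0 != ord0, u c0 != c0 & attached f x c0 (u c0)].
  by have := uP c0; rewrite rem0.
have [c00 _] := andP rem0.
have src i : removable f x i -> exists c, [/\ u c = i, c != i & attached f x c i].
  have [v _ vK] := injF_bij u_inj.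
  rewrite -{1}(vK i) uR => ri; exists (v i); have := uP (v i).
  by rewrite ri vK => -[_ iv ai]; split; rewrite 1?eq_sym.
have [b bd /[dup] gb /goodP bP] := core _ d0.
have [y0 [xy0 y0c y0b]] := attachedP ad gb bd.
have [m0 mc mP] := missingP (removableP rem0 xy0 y0c).
rewrite y0c in mc; have := mP _ y0b; rewrite bd eq_sym => md.
(* When [y0] leaves [c0] for its missing color, [b] sees that color at [y0] as well as at [z]; this
   frees [z] to take [c0]. *)
have [|z bz zm] := bP (missing f y0) m0; first by rewrite bd.
(* The closed walks ruled out below all run through the path x - y0 - b - z. *)
have zb : e z b by rewrite e_sym.
have by0 : e b y0 by rewrite e_sym.
have y0x : e y0 x by rewrite e_sym.
have bx : b != x by apply: contraNneq d0 => E; rewrite -bd E fx.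
have zx : z != x by apply: contraNneq m0 => E; rewrite -zm E fx.
have zy0 : z != y0 by apply: contraNneq mc => E; rewrite -zm E y0c.
have nxz : ~~ e x z.
  apply/negP => xz; case: (no_square xz zb by0 y0x _ zy0).
  by rewrite eq_sym.
(* Vertices reached from [x] through a neighbor other than [y0] are not adjacent to [z], by the
   absence of hexagons. *)
have far y w : e x y -> e y w -> w != x -> y != y0 -> ~~ e w z.
  move=> xy yw wx yy0; apply/negP => wz.
  have yz : y != z by apply: contraNneq nxz => <-.
  have wb : w != b.
    apply/eqP => E; subst w.
    by apply: (@no_square x y b y0); rewrite // eq_sym.
  by apply: (no_hexagon xy yw wz zb by0 y0x); rewrite // eq_sym.
apply: nsm; pose Z := [set x; z]; pose f' := recolor f c0 Z.
have f'Z v : v \in Z -> f' v = c0 by exact: recolor_in.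
have f'E v : f v != ord0 -> v != z ->
    (f v = c0 -> ~~ e x v /\ ~~ e z v) -> f' v = f v.
  move=> v0 vz H; apply: recolor_id => [|/H[/negP xv /negP zv] w].
    rewrite !inE negb_or vz andbT.
    by apply: contraNneq v0 => ->; rewrite fx.
  by rewrite !inE => /orP[] /eqP ->.
have f'E' v j : f v = j -> j != ord0 -> v != z -> j != c0 -> f' v = j.
  move=> <- j0 vz jc; apply: f'E => // E; by rewrite E eqxx in jc.
apply: (@recolor_smaller _ c0 Z x); rewrite ?inE ?eqxx //.
- move=> v w; rewrite !inE => /orP[] /eqP-> /orP[] /eqP->; rewrite ?e_irr //.
  by rewrite e_sym.
- move=> v w; rewrite !inE => /orP[] /eqP->; first exact: removableP.
  move=> zw wc; apply/negP => gw.
  (* A good vertex of color [c0] is reached from [x] through a color other than [c0], hence not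
     through [y0], so [far] keeps it away from [z]. *)
  have [c [_ cc0 ac]] := src _ rem0.
  have [y [xy yc yw]] := attachedP ac gw wc.
  have wx : w != x by apply: contraNneq c00 => E; rewrite -wc E fx.
  have yy0 : y != y0 by apply: contraNneq cc0 => E; rewrite -yc E y0c.
  by have /negP[] := far y w xy yw wx yy0; rewrite e_sym.
rewrite -/f' => i i0; have [->|ic] := eqVneq i c0.
  exists x; first by rewrite f'Z ?inE ?eqxx.
  apply/goodP => j j0; rewrite f'Z ?inE ?eqxx // => jc.
  have /goodP gx' := gx; have [|w xw wj] := gx' j j0; first by rewrite fx.
  exists w => //; apply: f'E' => //.
  by apply: contraNneq nxz => <-.
have [->|id] := eqVneq i (u c0).
  have f'b : f' b = u c0 by apply: f'E' => //; exact: edge_neq.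
  exists b => //; apply/goodP => j j0; rewrite f'b => jd.
  have [->|jc] := eqVneq j c0; first by exists z; rewrite // f'Z ?inE ?eqxx ?orbT.
  have [->|jm] := eqVneq j (missing f y0).
    exists y0 => //; rewrite /f' /recolor ifN; last first.
      by rewrite !inE negb_or eq_sym (edge_neq xy0) eq_sym zy0.
    rewrite ifT // y0c eqxx; apply/existsP; exists x.
    by rewrite !inE eqxx xy0.
  have [|w bw wj] := bP j j0; first by rewrite bd.
  exists w => //; apply: f'E' => //.
  by apply: contraNneq jm => E; rewrite -wj E zm.
(* A further color of M keeps a good vertex at distance 2 from [x], reached through some [y] other
   than [y0]. A color outside M keeps a good neighbor of [x]. *)
have [ri|/(not_removableP i0)[v [xv fv gv]]] := boolP (removable f x i).
  have [c [uc ci ac]] := src _ ri.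
  have cc0 : c != c0 by apply: contraNneq id => <-; rewrite uc.
  have [g gi /[dup] gg /goodP gP] := core i i0.
  have [y [xy yc yg]] := attachedP ac gg gi.
  have yy0 : y != y0 by apply: contraNneq cc0 => E; rewrite -yc E y0c.
  have gnx : g != x by apply: contraNneq i0 => E; rewrite -gi E fx.
  have ngz : ~~ e g z by exact: far xy yg gnx yy0.
  have gz : g != z.
    apply/eqP => E; subst g.
    by apply: (no_pentagon xy yg zb by0 y0x).
  have f'g : f' g = i by exact: f'E'.
  exists g => //; apply/goodP => j j0; rewrite f'g -gi => jg.
  have [w gw wj] := gP j j0 jg; exists w => //; rewrite /f' -wj.
  apply: f'E; rewrite ?wj //; first by apply: contraNneq ngz => <-.
  (* A neighbor of [g] of color [c0] could change only if adjacent to [x] or [z]; this would close a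
     square or a heptagon. *)
  move=> jc; split; apply/negP.
    move=> xw; have wy : w != y.
      by apply: contraNneq cc0 => E; rewrite -yc -E wj jc.
    apply: (no_square xy yg gw); rewrite 1?e_sym // eq_sym //.
  move=> zw; apply: (no_heptagon xy yg gw _ zb by0 y0x).
  by rewrite e_sym.
have vz : v != z by apply: contraNneq nxz => <-.
have f'v : f' v = i by exact: f'E'.
have /goodP vP := gv.
exists v => //; apply/goodP => j j0; rewrite f'v -fv => jv.
(* Neighbors of [v] of color [c0] may be recolored, but [x] now supplies that color. *)
have [->|jc] := eqVneq j c0.
  by exists x; rewrite 1?e_sym // f'Z ?inE ?eqxx.
have [w vw wj] := vP j j0 jv; exists w => //; apply: f'E' => //.
apply/eqP => E; subst w.
exact: (no_pentagon xv vw zb by0 y0x).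
Qed.

(** The minimal choice of class [ord0] becomes an induction on its size; if the class is empty, [f]
    itself is a b-coloring with colors 1, ..., k. *)
Lemma realizes_b_spectrum f (phi : T -> nat) :
  realizes f -> proper_coloring e phi -> (forall v, 0 < phi v < k) ->
  b_spectrum e k.
Proof.
move=> real pphi rphi.
have [n] := ubnP #|[pred v | f v == ord0]|; elim: n => // n IH in f real *.
rewrite ltnS => le_n.
have [[f' real' lt']|nsm] := EM (smaller f).
  by apply: (IH f' real'); exact: leq_trans lt' le_n.
have [prop core] := real.
have [x /eqP fx|f0] := pickP [pred v | f v == ord0].
  apply: (@iris_b_spectrum f x phi) => // c c0; apply: not_removableP => //.
  apply/negP => rem; apply: nsm.
  have [gx|ngx] := boolP (good f x); first exact: removable_smaller rem.
  exact: not_good_smaller ngx.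
have f0' v : f v != ord0 by have /= -> := f0 v.
apply: (@b_spectrum_intro _ (fun v => f v : nat)).
- by move=> u v /prop/eqP uv /ord_inj.
- by move=> v; rewrite lt0n -ltnS ltn_ord andbT; have := f0' v; rewrite -val_eqE.
have ordE (j : nat) : 0 < j <= k ->
    exists c : 'I_k.+1, (c != ord0) /\ (c = j :> nat).
  case/andP=> j0 jk; have jk' : j < k.+1 by [].
  by exists (Ordinal jk'); rewrite -val_eqE /= -lt0n.
move=> i /ordE[c [c0 <-]]; have [u uc /goodP gu] := core c c0.
exists u; first by rewrite uc.
move=> j /ordE[d [d0 <-]] dc; have [|w uw wd] := gu d d0.
  by apply/eqP => E; apply: dc; rewrite -uc E.
by exists w; rewrite // wd.
Qed.

End Coloring.

(** * Descent through the spectrum *)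

Lemma b_spectrum_pred k :
  chromatic_number e < k -> b_spectrum e k.+1 -> b_spectrum e k.
Proof.
move=> chik [psi [psiP psi_b]].
have [[chi chiP] _] := chromatic_numberP e_irr.
have [s ss [us mem_s s_lt]] := coloring_index psiP.
have [s' ss' [us' mem_s' s'_lt]] := coloring_index chiP.
have s_mem v : psi v \in s by rewrite mem_s codom_f.
have s'_mem v : chi v \in s' by rewrite mem_s' codom_f.
pose f v : 'I_k.+1 := Ordinal (s_lt v).
have f_nth v : psi v = nth 0 s (f v) by rewrite nth_index.
(* The shift by one puts an optimal coloring into 1, ..., k - 1: color 0 is avoided and k stays free
   for the vertices in conflict. *)
apply: (@realizes_b_spectrum k f (fun v => (index (chi v) s').+1)); last 2 first.
- move=> u v uv [] /(congr1 (nth 0 s')); rewrite !nth_index //.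
  exact: chiP.1.
- by move=> v; apply: leq_ltn_trans (s'_lt v) chik.
have mem_nth_s (i : 'I_k.+1) : nth 0 s i \in codom psi.
  by rewrite -mem_s mem_nth // ss.
have f_eq v (i : 'I_k.+1) : psi v = nth 0 s i -> f v = i.
  by move=> vi; apply/val_inj; rewrite /= vi index_uniq // ss.
split=> [u v uv|i _].
  by apply/eqP => E; apply: (psiP.1 _ _ uv); rewrite !f_nth E.
have [u ui ub] := psi_b _ (mem_nth_s i).
exists u; first exact: f_eq.
apply/goodP => j _ ju.
have [|w uw wj] := ub _ (mem_nth_s j); last by exists w => //; exact: f_eq.
by move/esym/f_eq => E; rewrite E eqxx in ju.
Qed.

End GirthEight.

Theorem theorem1 (T : finType) (e : rel T)
    (e_sym : symmetric e) (e_irr : irreflexive e)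
    (e_girth : girth_geq e 8) :
  b_continuous e.
Proof.
have [_ chi_le] := chromatic_numberP e_irr.
have [bS le_b] := b_chromatic_numberP e_sym e_irr.
apply/funext => k; apply/propext; split=> [Sk|/andP[chik]].
  by apply/andP; split; [case: Sk => psi [/chi_le] | exact: le_b Sk].
(* Downward induction from b(G), with [n] the distance from [k] up to it. *)
move=> /subnKC; move: (_ - k) => n; elim: n => [|n IH] in k chik *.
  by rewrite addn0 => ->.
rewrite addnS -addSn => kb; move: chik; rewrite leq_eqVlt => /orP[/eqP <-|chik].
  exact: chromatic_number_spectrum.
by apply: b_spectrum_pred => //; apply: IH => //; exact/leqW/ltnW.
Qed.
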